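(* Let $\pi$ be a policy in a discounted MDP with $n$ states and discount factor $\gamma\in[0,1)$, with transition matrix $\mathcal{P}^\pi\in\mathbb{R}^{n\times n}$, reward vector $r^\pi\in\mathbb{R}^n$ and value function $V^\pi$. Let $\lambda_1,\dots,\lambda_n$ be the eigenvalues of $\mathcal{P}^\pi$ (with algebraic multiplicity) sorted in decreasing order of magnitude with ties broken arbitrarily, and set $\lambda_{n+1}:=0$. Let $1\le s\le n$ and let $E_s=\sum_{i=1}^s\lambda_iu_iv_i^\top$ be a rank-$s$ deflation matrix of $\mathcal{P}^\pi$ (of Hotelling, Wielandt, or Schur type). For $\alpha=1$, the DDVI iteration $$W^{k+1}=(1-\alpha)V^k+\alpha r^\pi+\alpha\gamma(\mathcal{P}^\pi-E_s)V^k,\qquad V^{k+1}=\Big(I+\sum_{i=1}^s\frac{\alpha\gamma\lambda_i}{1-\alpha\gamma\lambda_i}u_iv_i^\top\Big)W^{k+1}$$ simplifies to $$W^{k+1}=\gamma(\mathcal{P}^\pi-E_s)V^k+r^\pi,\qquad V^{k+1}=\Big(I+\sum_{i=1}^s\frac{\gamma\lambda_i}{1-\gamma\lambda_i}u_iv_i^\top\Big)W^{k+1},$$ and, for any initial $V^0\in\mathbb{R}^n$, its iterates satisfy $$\|V^k-V^\pi\|=\tilde O\big(|\gamma\lambda_{s+1}|^k\,\|V^0-V^\pi\|\big)\quad\text{as }k\to\infty.$$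
   Context: A discounted MDP here has a finite state space $\mathcal{X}$ with $|\mathcal{X}|=n$, an action space $\mathcal{A}$, a transition kernel $\mathcal{P}(\cdot\mid x,a)$, expected rewards $r(x,a)$ and discount factor $\gamma\in[0,1)$. A policy $\pi$ maps states to distributions over actions; $r^\pi(x)=\mathbf{E}_{a\sim\pi(\cdot\mid x)}[r(x,a)]$, and $\mathcal{P}^\pi$ is the (row-)stochastic matrix $\mathcal{P}^\pi(x'\mid x)=\sum_a\pi(a\mid x)\mathcal{P}(x'\mid x,a)$ (an integral if actions are continuous). The value function $V^\pi$ is the unique solution of $(I-\gamma\mathcal{P}^\pi)V^\pi=r^\pi$. Throughout, $u^\top$ denotes the conjugate transpose of $u\in\mathbb{C}^n$, and $\|\cdot\|$ is the $\ell^\infty$ norm (iterates may be in $\mathbb{C}^n$). Rank-$s$ deflation matrix of $\mathcal{P}^\pi$: a matrix $E_s=\sum_{i=1}^s\lambda_iu_iv_i^\top$ such that one of the following holds. (Hotelling) There exist $s$ linearly independent right eigenvectors corresponding to $\lambda_1,\dots,\lambda_s$; $u_1,\dots,u_s$ are such right eigenvectors ($\mathcal{P}^\pi u_i=\lambda_iu_i$) and $v_1,\dots,v_s$ are corresponding left eigenvectors ($v_i^\top\mathcal{P}^\pi=\lambda_iv_i^\top$), scaled so that $u_i^\top v_i=1$ and $u_i^\top v_j=0$ for $1\le i\ne j\le s$. (Wielandt) $u_1,\dots,u_s$ are linearly independent right eigenvectors corresponding to $\lambda_1,\dots,\lambda_s$, and $v_1,\dots,v_s$ are any vectors (not necessarily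 left eigenvectors) with $u_i^\top v_i=1$ and $u_i^\top v_j=0$ for $1\le i\neq j\le s$. (Schur) $v_i=u_i$, where $u_1,\dots,u_s$ are the first $s$ columns of a unitary matrix $U$ in a Schur decomposition $\mathcal{P}^\pi=URU^\top$, with $R$ upper triangular and $R_{ii}=\lambda_i$ for $i=1,\dots,n$. For $\mu\ge 0$, the notation $\|V^k-V^\pi\|=\tilde O(\mu^k\|V^0-V^\pi\|)$ as $k\to\infty$ means: for every $\epsilon>0$, $\|V^k-V^\pi\|=O((\mu+\epsilon)^k\|V^0-V^\pi\|)$ as $k\to\infty$, i.e. there are constants $C,K$ (not depending on $k$) with $\|V^k-V^\pi\|\le C(\mu+\epsilon)^k\|V^0-V^\pi\|$ for all $k\ge K$. *)

(* Defs.v *)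
From HB Require Import structures.
From mathcomp Require Import all_boot all_order all_algebra.
From mathcomp Require Import spectral sesquilinear.
From mathcomp Require Import complex.
From mathcomp Require Import all_classical all_reals all_analysis.
Set Implicit Arguments.
Unset Strict Implicit.
Unset Printing Implicit Defensive.
Import Order.TTheory GRing.Theory Num.Theory.
Import numFieldNormedType.Exports.

Local Open Scope ring_scope.
Local Open Scope sesquilinear_scope.
Local Open Scope complex_scope.

(* The action space is an arbitrary measurable space: a finite action space is
   the case of the discrete sigma-algebra, where the integrals below are the
   sums over the actions. *)
Record mdp (R : realType) (X : finType) (d : measure_display)
    (A : measurableType d) := Mdp {
  trans : X -> A -> X -> R;  (* [trans x a x'] is P(x' | x, a) *)
  trans_ge0 : forall x a x', 0 <= trans x a x';
  trans_sum1 : forall x a, \sum_(x' : X) trans x a x' = 1;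
  measurable_trans : forall x x', measurable_fun setT (fun a => trans x a x');
  reward : X -> A -> R;
  measurable_reward : forall x, measurable_fun setT (reward x);
  discount : R;
  discount_ge0 : 0 <= discount;
  discount_lt1 : discount < 1
}.

Definition policy (R : realType) (X : finType) (d : measure_display)
    (A : measurableType d) := X -> probability A R.

Definition integrable_reward (R : realType) (X : finType)
    (d : measure_display) (A : measurableType d)
    (M : mdp R X A) (pi : policy R X A) : Prop :=
  forall x, (pi x).-integrable setT (EFin \o reward M x).

(* Row x, column x'; states are indexed by their rank in the enumeration of X. *)
Definition transition_mx (R : realType) (X : finType) (d : measure_display)
    (A : measurableType d) (M : mdp R X A) (pi : policy R X A) : 'M[R]_#|X| :=
  \matrix_(i, j)
    \int[pi (enum_val i)]_(a in setT) trans M (enum_val i) a (enum_val j).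

Definition reward_vec (R : realType) (X : finType) (d : measure_display)
    (A : measurableType d) (M : mdp R X A) (pi : policy R X A) : 'cV[R]_#|X| :=
  \col_i \int[pi (enum_val i)]_(a in setT) reward M (enum_val i) a.

Definition is_value_function (R : realType) (X : finType)
    (d : measure_display) (A : measurableType d)
    (M : mdp R X A) (pi : policy R X A) (V : 'cV[R]_#|X|) : Prop :=
  (1%:M - discount M *: transition_mx M pi) *m V = reward_vec M pi.

Definition to_complex_mx (R : realType) (m n : nat) (B : 'M[R]_(m, n)) :
  'M[R[i]]_(m, n) := map_mx (real_complex R) B.

(* The factorization forces size lam = n, so lam`_i is lambda_{i+1} for i < n
   and lam`_n = 0 is the convention lambda_{n+1} = 0. *)
Definition sorted_eigenvalues (C : numClosedFieldType) (n : nat)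
    (P : 'M[C]_n) (lam : seq C) : Prop :=
  char_poly P = \prod_(z <- lam) ('X - z%:P) /\
  sorted (fun a b => `|b| <= `|a|) lam.

Section Deflation.
Variables (C : numClosedFieldType) (n : nat) (P : 'M[C]_n) (lam : seq C).
Variables (s : nat) (u v : 'I_s -> 'cV[C]_n).

Definition right_eigenvectors : Prop :=
  free [seq u i | i : 'I_s] /\ forall i, P *m u i = lam`_i *: u i.

Definition left_eigenvectors : Prop :=
  forall i, (v i)^t* *m P = lam`_i *: (v i)^t*.

Definition biorthonormal : Prop :=
  forall i j, (u i)^t* *m v j = (i == j)%:R%:M.

Definition hotelling_deflation : Prop :=
  [/\ right_eigenvectors, left_eigenvectors & biorthonormal].

Definition wielandt_deflation : Prop := right_eigenvectors /\ biorthonormal.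

Definition schur_deflation : Prop :=
  exists U T : 'M[C]_n,
    [/\ U \is unitarymx, P = U *m T *m U^t*,
        (forall i j : 'I_n, (j < i)%N -> T i j = 0),
        (forall i : 'I_n, T i i = lam`_i)
      & (forall (i : 'I_s) (j : 'I_n), i = j :> nat -> u i = col j U) /\
        (forall i, v i = u i)].

Definition is_deflation : Prop := [\/ hotelling_deflation, wielandt_deflation | schur_deflation].

Definition deflation_mx : 'M[C]_n :=
  \sum_(i < s) lam`_i *: (u i *m (v i)^t*).

(* The recursion constrains W at positive indices only; W 0 is irrelevant. *)
Definition is_ddvi (alpha gamma : C) (r : 'cV[C]_n)
    (W V : nat -> 'cV[C]_n) : Prop :=
  forall k : nat,
    W k.+1 = (1 - alpha) *: V k + alpha *: r
             + (alpha * gamma) *: ((P - deflation_mx) *m V k) /\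
    V k.+1 = (1%:M + \sum_(i < s) (alpha * gamma * lam`_i
                       / (1 - alpha * gamma * lam`_i)) *: (u i *m (v i)^t*))
             *m W k.+1.

Definition is_ddvi_simplified (gamma : C) (r : 'cV[C]_n)
    (W V : nat -> 'cV[C]_n) : Prop :=
  forall k : nat,
    W k.+1 = gamma *: ((P - deflation_mx) *m V k) + r /\
    V k.+1 = (1%:M + \sum_(i < s) (gamma * lam`_i / (1 - gamma * lam`_i))
                       *: (u i *m (v i)^t*))
             *m W k.+1.

End Deflation.

(* ||e k|| = \tilde O(mu^k ||e0||) as k -> oo; [mx_norm] is the l^oo norm. The
   norms are R[i]-valued, and <= on R[i] is the order of R on real elements. *)
Definition tildeO_geom (R : realType) (n : nat) (e : nat -> 'cV[R[i]]_n)
    (mu : R[i]) (e0 : 'cV[R[i]]_n) : Prop :=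
  forall eps : R, 0 < eps ->
  exists (c : R) (K : nat), forall k : nat, (K <= k)%N ->
    mx_norm (e k) <= c%:C * (mu + eps%:C) ^+ k * mx_norm e0.

(* Main.v *)
Require Import Defs.
From mathcomp Require Import all_boot all_order all_algebra.
From mathcomp Require Import spectral sesquilinear ring.
From mathcomp Require Import complex.
From mathcomp Require Import all_classical all_reals all_analysis.
From mathcomp Require Import measurable_realfun.
Set Implicit Arguments.
Unset Strict Implicit.
Unset Printing Implicit Defensive.
Import Order.TTheory GRing.Theory Num.Theory.
Local Open Scope ring_scope.
Local Open Scope sesquilinear_scope.

(* Write D for the deflation matrix. Since v_i^* u_j = delta_ij, the correction
   S = 1 + sum_i gamma lambda_i / (1 - gamma lambda_i) u_i v_i^* is the inverse
   of 1 - gamma D, so V^pi is a fixed point and the error obeys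
   e_(k+1) = S gamma (P - D) e_k.
   When the u_i are eigenvectors, (P - D) u_i = 0, hence
   (S gamma (P - D))^k = S (gamma (P - D))^k, and the characteristic polynomial
   of P - D is that of P with lambda_1, ..., lambda_s replaced by 0. In the
   Schur case the iteration matrix is upper triangular in the Schur basis, with
   diagonal 0, ..., 0, gamma lambda_(s+1), ..., gamma lambda_n. By
   Cayley-Hamilton, e_k is in both cases governed by powers of a matrix G with
   prod_z (G - z) = 0, where every |z| <= |gamma lambda_(s+1)|; the powers of
   such a G grow at most like (|gamma lambda_(s+1)| + eps)^k. *)

(** * Determinants and characteristic polynomials under deflation *)

Lemma det_1addmulC (R : comNzRingType) (m n : nat) (A : 'M[R]_(m, n))
    (B : 'M[R]_(n, m)) :
  \det (1%:M + A *m B) = \det (1%:M + B *m A).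
Proof.
(* Two block-triangular factorizations of one matrix, with rows [1, -A] and [B, 1]; its determinant
   computed both ways gives the identity. *)
have eq1 : block_mx 1%:M 0 B 1%:M *m block_mx 1%:M (- A) 0 (1%:M + B *m A) =
           block_mx 1%:M (- A) B 1%:M.
  by rewrite mulmx_block !mul1mx !mul0mx !mulmx1 ?mulmx0 ?addr0 ?add0r
             mulmxN addrCA addNr addr0.
have eq2 : block_mx 1%:M (- A) 0 1%:M *m block_mx (1%:M + A *m B) 0 B 1%:M =
           block_mx 1%:M (- A) B 1%:M.
  by rewrite mulmx_block !mul1mx !mul0mx !mulmx1 ?mulmx0 ?addr0 ?add0r
             mulNmx addrK.
have := congr1 determinant (etrans eq1 (esym eq2)).
by rewrite !det_mulmx !det_ublock !det_lblock !det1 !mul1r !mulr1 => ->.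
Qed.

Lemma char_poly_tr (R : comNzRingType) (n : nat) (A : 'M[R]_n) :
  char_poly A^T = char_poly A.
Proof.
rewrite /char_poly -[RHS]det_tr; congr (\det _).
by rewrite /char_poly_mx raddfB /= tr_scalar_mx map_trmx.
Qed.

Lemma char_poly_diag (R : comNzRingType) (n : nat) (l : 'rV[R]_n) :
  char_poly (diag_mx l) = \prod_(i < n) ('X - (l 0 i)%:P).
Proof.
rewrite char_poly_trig ?diag_mx_is_trig//.
by apply: eq_bigr => i _; rewrite mxE eqxx.
Qed.

(** After expansion with [Y U = U Z] and [V U = 1], both sides are [Y] plus a term [U _ V]; the
    middle factors agree because Z (Z - 1) + L Z = (Z + L) Z - Z = (x - 1) Z. *)
Lemma deflation_identity (R : comPzRingType) (n s : nat) (Y : 'M[R]_n)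
    (U : 'M[R]_(n, s)) (V : 'M[R]_(s, n)) (Z L : 'M[R]_s) (x : R) :
  Y *m U = U *m Z -> V *m U = 1%:M -> Z + L = x%:M ->
  (Y + U *m L *m V) *m (1%:M + U *m ((Z - 1%:M) *m V)) =
  Y *m (1%:M + U *m ((x%:M - 1%:M) *m V)).
Proof.
move=> YU VU ZL.
rewrite mulmxDl !mulmxDr !mulmx1 -addrA; congr (_ + _).
rewrite ![Y *m (_ *m _)]mulmxA YU -!mulmxA [V *m (U *m _)]mulmxA VU mul1mx.
rewrite -!mulmxDr; congr (_ *m _).
have -> : V + (Z - 1%:M) *m V = Z *m V by rewrite mulmxBl mul1mx addrC subrK.
by rewrite !mulmxBl !mul1mx !mulmxBr addrAC !mulmxA -!mulmxDl ZL scalar_mxC.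
Qed.

(* With Z := X - L one has (X - P) U = U Z, so that
   (X - P + U L V) (1 + U (Z - 1) V) = (X - P) (1 + (X - 1) U V);
   Sylvester's identity evaluates both extra determinants. *)
Lemma char_poly_deflation (R : comNzRingType) (n s : nat) (P : 'M[R]_n)
    (U : 'M[R]_(n, s)) (V : 'M[R]_(s, n)) (L : 'M[R]_s) :
  P *m U = U *m L -> V *m U = 1%:M ->
  char_poly (P - U *m L *m V) * char_poly L = char_poly P * 'X^s.
Proof.
move=> PU VU; pose p m k (B : 'M[R]_(m, k)) := map_mx (@polyC R) B.
have pM m k l (B : 'M[R]_(m, k)) (D : 'M[R]_(k, l)) :
    p _ _ (B *m D) = p _ _ B *m p _ _ D.
  by rewrite /p map_mxM.
have pVU : p _ _ V *m p _ _ U = 1%:M by rewrite -pM VU /p map_mx1.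
have detU (Z : 'M[{poly R}]_s) :
    \det (1%:M + p _ _ U *m ((Z - 1%:M) *m p _ _ V)) = \det Z.
  by rewrite det_1addmulC -mulmxA pVU mulmx1 addrC subrK.
rewrite -[char_poly L]detU -det_scalar -(detU 'X%:M) -!det_mulmx.
congr (\det _).
rewrite -(deflation_identity (Z := 'X%:M - p _ _ L) (L := p _ _ L)).
- by rewrite /char_poly_mx map_mxB opprB addrCA [in RHS]addrC -!pM.
- by rewrite mulmxBl mulmxBr -!pM PU scalar_mxC.
- by [].
- by rewrite subrK.
Qed.

(** * Annihilating products and growth of matrix powers *)

Lemma prod_char_poly_roots (R : comNzRingType) (n : nat) (A : 'M[R]_n)
    (l : seq R) :
  char_poly A = \prod_(z <- l) ('X - z%:P) -> \prod_(z <- l) (A - z%:M) = 0.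
Proof.
case: n A => [|n] A charA; first exact: flatmx0.
rewrite -(Cayley_Hamilton A) charA rmorph_prod; apply: eq_bigr => z _ /=.
by rewrite rmorphB /= horner_mx_X horner_mx_C.
Qed.

Lemma prod_scale_sub (R : comNzRingType) (n : nat) (A : 'M[R]_n) (c : R)
    (l : seq R) :
  \prod_(z <- l) (A - z%:M) = 0 ->
  \prod_(z <- [seq c * z | z <- l]) (c *: A - z%:M) = 0.
Proof.
move=> prod0; rewrite big_map.
suff -> : \prod_(z <- l) (c *: A - (c * z)%:M) =
          c ^+ size l *: \prod_(z <- l) (A - z%:M) by rewrite prod0 scaler0.
elim: l {prod0} => [|z l IHl] /=; first by rewrite !big_nil scale1r.
rewrite !big_cons IHl -scale_scalar_mx -scalerBr /GRing.mul /=.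
by rewrite -scalemxAl -scalemxAr scalerA -exprS.
Qed.

(* Induction on the roots: Y_k := X A^k solves Y_(k+1) = z Y_k + X (A - z) A^k,
   where X (A - z) is annihilated by the remaining factors. *)
Lemma annihilated_growth (C : numFieldType) (m n : nat) (A : 'M[C]_n) (rho : C)
    (l : seq C) (X : 'M[C]_(m, n)) :
  0 <= rho -> {in l, forall z, `|z| < rho} ->
  X *m \prod_(z <- l) (A - z%:M) = 0 ->
  exists2 c : C, 0 <= c &
    forall k i j, `|(X *m A ^+ k) i j| <= c * rho ^+ k.
Proof.
move=> rho0; elim: l X => [|z l IHl] X ltrho.
  rewrite big_nil mulmx1 => ->; exists 0 => // k i j.
  by rewrite mul0mx mxE normr0 mul0r.
rewrite big_cons mulmxA => X0.
have [|c c0 boundc] := IHl _ _ X0.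
  by move=> w wl; apply: ltrho; rewrite inE wl orbT.
have ltz : 0 < rho - `|z| by rewrite subr_gt0 ltrho// mem_head.
pose N := \sum_i \sum_j `|X i j|.
have N0 : 0 <= N by apply: sumr_ge0 => i _; apply: sumr_ge0.
(* [N] bounds every entry of [X], which settles k = 0. With q = c / (rho - |z|), c + |z| (N + q) = q
   rho + N |z| <= (N + q) rho closes the induction. *)
exists (N + c / (rho - `|z|)) => [|k i j].
  by rewrite addr_ge0// divr_ge0// ltW.
elim: k => [|k IHk].
  rewrite expr0 mulr1 mulmx1 -[leLHS]addr0 lerD ?divr_ge0 ?(ltW ltz)//.
  rewrite /N (bigD1 i)//= (bigD1 j)//= -addrA ler_wpDr//.
  by rewrite addr_ge0 ?sumr_ge0// => i' _; apply: sumr_ge0.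
have -> : X *m A ^+ k.+1 = X *m (A - z%:M) *m A ^+ k + z *: (X *m A ^+ k).
  rewrite mulmxBr mulmxBl mul_mx_scalar -scalemxAl subrK exprS.
  by rewrite -mulmxA.
rewrite mxE [X in `|_ + X|]mxE (le_trans (ler_normD _ _))// normrM.
have zrho : 0 <= `|z| by [].
apply: le_trans (lerD (boundc k i j) (ler_wpM2l zrho IHk)) _.
rewrite exprS !mulrA -!mulrDl ler_wpM2r ?exprn_ge0//.
set q := c / _; have -> : c = q * (rho - `|z|) by rewrite divfK ?gt_eqF.
have -> : q * (rho - `|z|) + `|z| * (N + q) = q * rho + N * `|z| by ring.
by rewrite addrC mulrDl lerD2r ler_wpM2l// ltW// -subr_gt0.
Qed.

(** * Factored form of the rank-s sums and the error recursion *)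

Definition cols_mx (C : numClosedFieldType) (n s : nat) (u : 'I_s -> 'cV[C]_n) :
  'M[C]_(n, s) := \matrix_(a, i) u i a 0.

Lemma sum_outer (C : numClosedFieldType) (n s : nat) (c : 'I_s -> C)
    (u v : 'I_s -> 'cV[C]_n) :
  \sum_i c i *: (u i *m (v i)^t*) =
  cols_mx u *m diag_mx (\row_i c i) *m (cols_mx v)^t*.
Proof.
apply/matrixP => a b; rewrite summxE mxE; apply: eq_bigr => i _.
by rewrite mul_mx_diag !mxE big_ord1 !mxE mulrCA mulrA.
Qed.

Lemma biorthonormal_mx (C : numClosedFieldType) (n s : nat)
    (u v : 'I_s -> 'cV[C]_n) :
  biorthonormal u v -> (cols_mx v)^t* *m cols_mx u = 1%:M.
Proof.
move=> uv; apply/matrixP => i j; rewrite !mxE.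
(* The entry sought is the conjugate of the product in [uv], hence the swapped indices. *)
have := congr1 (fun B : 'M[C]_1 => (B 0 0)^*) (uv j i).
rewrite !mxE eqxx mulr1n rmorph_sum /= conjC_nat eq_sym => <-.
by apply: eq_bigr => a _; rewrite !mxE rmorphM /= conjCK mulrC.
Qed.

(** Since [V U = 1], the product is 1 + U (F - G - F G) V, and the diagonal middle factor vanishes:
    g / (1 - g) - g = g^2 / (1 - g). *)
Lemma correction_inverse (C : fieldType) (n s : nat) (U : 'M[C]_(n, s))
    (V : 'M[C]_(s, n)) (g : 'I_s -> C) :
  V *m U = 1%:M -> (forall i, 1 - g i != 0) ->
  (1%:M + U *m diag_mx (\row_i (g i / (1 - g i))) *m V) *m
    (1%:M - U *m diag_mx (\row_i g i) *m V) = 1%:M.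
Proof.
move=> VU g1; set F := diag_mx _; set G := diag_mx _.
have FG : F - G - F *m G = 0.
  apply/matrixP => i j; rewrite /F /G mulmx_diag !mxE -!mulrnBl.
  suff -> : g i / (1 - g i) - g i - g i / (1 - g i) * g i = 0 by rewrite mul0rn.
  by field; exact: g1.
rewrite mulmxDl mul1mx mulmxBr mulmx1 -!mulmxA [V *m (U *m _)]mulmxA VU mul1mx.
rewrite -addrA [X in 1%:M + X](_ : _ = U *m ((F - G - F *m G) *m V)).
  by rewrite FG mul0mx mulmx0 addr0.
by rewrite !mulmxBl !mulmxBr !mulmxA addrCA addrA.
Qed.

Lemma ddvi1_simplified (C : numClosedFieldType) (n : nat) (P : 'M[C]_n)
    (lam : seq C) (s : nat) (u v : 'I_s -> 'cV[C]_n) (gamma : C) (r : 'cV[C]_n)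
    (W V : nat -> 'cV[C]_n) :
  is_ddvi P lam u v 1 gamma r W V <-> is_ddvi_simplified P lam u v gamma r W V.
Proof.
rewrite /is_ddvi /is_ddvi_simplified subrr mul1r.
have eqW k : 0 *: V k + 1 *: r + gamma *: ((P - deflation_mx lam u v) *m V k) =
    gamma *: ((P - deflation_mx lam u v) *m V k) + r.
  by rewrite scale0r add0r scale1r addrC.
by split=> H k; have := H k; rewrite eqW.
Qed.

(** Write [Vs] as S (1 - gamma D) Vs and r as (1 - gamma P) Vs: the constant terms combine to -
    gamma (P - D) Vs under [S]. *)
Lemma ddvi_error (C : comPzRingType) (n : nat) (P D S : 'M[C]_n) (gamma : C)
    (r Vs : 'cV[C]_n) (V : nat -> 'cV[C]_n) :
  (1%:M - gamma *: P) *m Vs = r -> S *m (1%:M - gamma *: D) = 1%:M ->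
  (forall k, V k.+1 = S *m (gamma *: ((P - D) *m V k) + r)) ->
  forall k, V k.+1 - Vs = S *m (gamma *: (P - D)) *m (V k - Vs).
Proof.
move=> <- SD VE k.
have VsE : Vs = S *m ((1%:M - gamma *: D) *m Vs) by rewrite mulmxA SD mul1mx.
rewrite VE [X in _ - X = _]VsE -mulmxBr -mulmxA; congr (_ *m _).
rewrite scalemxAl [RHS]mulmxBr -addrA -mulmxBl -mulNmx; congr (_ + _ *m _).
by rewrite scalerBr !opprD !opprK addrACA subrr add0r.
Qed.

(** * The transition matrix is stochastic, so its eigenvalues lie in the unit disc *)

Lemma Rintegral_sum (R : realType) (d : measure_display) (T : measurableType d)
    (mu : {measure set T -> \bar R}) (D : set T) (I : Type) (r : seq I)
    (f : I -> T -> R) :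
  measurable D -> (forall i, mu.-integrable D (EFin \o f i)) ->
  \int[mu]_(x in D) (\sum_(i <- r) f i x) =
  \sum_(i <- r) \int[mu]_(x in D) f i x.
Proof.
move=> mD intf; elim: r => [|i r IHr].
  under eq_Rintegral do rewrite big_nil.
  by rewrite big_nil Rintegral_cst// mul0r.
rewrite big_cons -IHr -RintegralD//.
  by apply: eq_Rintegral => x _; rewrite big_cons.
rewrite (_ : _ \o _ = fun x => (\sum_(j <- r) (f j x)%:E)%E).
  by apply: integrable_sum => // j _; exact: intf.
by apply/funext => x /=; rewrite sumEFin.
Qed.

Lemma transition_mx_stochastic (R : realType) (X : finType)
    (d : measure_display) (A : measurableType d) (M : mdp R X A)
    (pi : policy R X A) :
  (forall i j, 0 <= transition_mx M pi i j) /\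
  (forall i, \sum_j transition_mx M pi i j = 1).
Proof.
split=> [i j|i]; first by rewrite mxE Rintegral_ge0// => a _; exact: trans_ge0.
(* Each transition probability is a nonnegative term of a sum equal to 1, so the constant 1
   dominates it. *)
have tr_int x x' : (pi x).-integrable setT (EFin \o (fun a => trans M x a x')).
  apply: (le_integrable measurableT _ _
    (finite_measure_integrable_cst (pi x) 1 measurableT)).
    by apply/measurable_EFinP; exact: measurable_trans.
  move=> a _; rewrite /= lee_fin normr1 ger0_norm ?trans_ge0//.
  rewrite -(trans_sum1 M x a) (bigD1 x')//= lerDl sumr_ge0// => y _.
  exact: trans_ge0.
under eq_bigr do rewrite mxE.
rewrite -(big_enum_val (fun y =>
  \int[pi (enum_val i)]_(a in setT) trans M (enum_val i) a y)) /=.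
rewrite -Rintegral_sum//; last by move=> y; exact: tr_int.
under eq_Rintegral do rewrite trans_sum1.
rewrite Rintegral_cst// mul1r.
by rewrite (congr1 fine (probability_setT (pi (enum_val i)))).
Qed.

(* A left eigenvector does not grow in l^1 norm under a stochastic matrix. *)
Lemma stochastic_eigenvalue_le1 (C : numFieldType) (n : nat) (P : 'M[C]_n)
    (z : C) :
  (forall i j, 0 <= P i j) -> (forall i, \sum_j P i j = 1) ->
  root (char_poly P) z -> `|z| <= 1.
Proof.
move=> P0 P1; rewrite -eigenvalue_root_char => /eigenvalueP[x xP x0].
pose N := \sum_j `|x 0 j|.
have N0 : 0 < N.
  have /rV0Pn[j xj] := x0.
  by rewrite /N (bigD1 j)//= ltr_pwDl ?normr_gt0// sumr_ge0.
rewrite -(ler_pM2r N0) mul1r mulr_sumr.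
have -> : N = \sum_j \sum_i `|x 0 i| * P i j.
  by rewrite exchange_big; apply: eq_bigr => i _; rewrite -mulr_sumr P1 mulr1.
apply: ler_sum => j _; rewrite -normrM.
have -> : z * x 0 j = (x *m P) 0 j by rewrite xP mxE.
rewrite mxE (le_trans (ler_norm_sum _ _ _))//.
by apply: ler_sum => i _; rewrite normrM (ger0_norm (P0 _ _)).
Qed.

(** * From entrywise growth to the sup norm *)

Lemma mx_norm_ge_entry (K : numDomainType) (m n : nat) (x : 'M[K]_(m, n)) i j :
  `|x i j| <= mx_norm x.
Proof.
rewrite mx_normE.
exact: (le_bigmax _ (fun ij => (`|x ij.1 ij.2|)%:nng) (i, j)).
Qed.

Lemma mx_norm_le_entries (K : numDomainType) (m n : nat) (x : 'M[K]_(m, n))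
    (c : K) :
  0 <= c -> (forall i j, `|x i j| <= c) -> mx_norm x <= c.
Proof.
move=> c0 xc; have [->//|/mx_norm_neq0[i ->]] := eqVneq (mx_norm x) 0.
exact: xc.
Qed.

Local Open Scope complex_scope.

(** The margin [eps] puts all roots strictly below [rho], as the growth bound requires; [Y] only
    costs the constant factor [b]. *)
Lemma annihilated_tildeO (R : realType) (m n : nat) (e : nat -> 'cV[R[i]]_n)
    (X : 'M[R[i]]_(n, m)) (G : 'M[R[i]]_m) (Y : 'M[R[i]]_(m, n)) (l : seq R[i])
    (mu : R[i]) (e0 : 'cV[R[i]]_n) :
  0 <= mu -> {in l, forall z, `|z| <= mu} -> \prod_(z <- l) (G - z%:M) = 0 ->
  (forall k, e k.+1 = X *m G ^+ k.+1 *m (Y *m e0)) ->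
  tildeO_geom e mu e0.
Proof.
move=> mu0 lmu G0 eE eps eps0; pose rho := mu + eps%:C.
have mu_rho : mu < rho by rewrite ltrDl ltcR.
have rho0 : 0 <= rho := le_trans mu0 (ltW mu_rho).
have lrho : {in l, forall z, `|z| < rho}.
  by move=> z zl; exact: le_lt_trans (lmu z zl) mu_rho.
have [c c0 cP] : exists2 c, 0 <= c &
    forall k i j, `|(X *m G ^+ k) i j| <= c * rho ^+ k.
  by apply: annihilated_growth rho0 lrho _; rewrite G0 mulmx0.
pose b := \sum_i \sum_j `|Y i j|.
have b0 : 0 <= b by apply: sumr_ge0 => i _; apply: sumr_ge0.
(* The formula for [e] starts at index 1, hence this threshold. [c * b] is real, so taking its real
   part loses nothing. *)
exists (complex.Re (c * b)), 1%N => -[//|k] _.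
rewrite -/rho RRe_real ?ger0_real ?mulr_ge0// eE.
have N0 : 0 <= mx_norm e0 by rewrite mx_normE.
apply: mx_norm_le_entries => [|i j]; first by rewrite !mulr_ge0// exprn_ge0.
rewrite mxE (le_trans (ler_norm_sum _ _ _))//.
have -> : c * b * rho ^+ k.+1 * mx_norm e0 =
    \sum_a (c * rho ^+ k.+1) * (\sum_a' `|Y a a'| * mx_norm e0).
  under eq_bigr do rewrite -mulr_suml.
  by rewrite -mulr_sumr -mulr_suml -/b; ring.
apply: ler_sum => a _; rewrite normrM ler_pM//.
rewrite mxE (le_trans (ler_norm_sum _ _ _))// ler_sum// => a' _.
by rewrite normrM ler_wpM2l// mx_norm_ge_entry.
Qed.

(** * Sorted eigenvalues, and the deflated matrix in each setting *)

Lemma sorted_eigenvalues_size (C : numClosedFieldType) (n : nat) (P : 'M[C]_n)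
    (lam : seq C) : sorted_eigenvalues P lam -> size lam = n.
Proof.
case=> charP _; have := size_char_poly P.
by rewrite charP size_prod_XsubC => -[].
Qed.

Lemma sorted_eigenvalues_le (C : numClosedFieldType) (n : nat) (P : 'M[C]_n)
    (lam : seq C) (i j : nat) :
  sorted_eigenvalues P lam -> (i <= j)%N -> `|lam`_j| <= `|lam`_i|.
Proof.
case=> _ sorted_lam ij; have [ltj|gej] := ltnP j (size lam); last first.
  (* Past the end the default is 0; this covers the convention lambda_(n+1) = 0. *)
  by rewrite (nth_default _ gej) normr0.
apply: (sorted_leq_nth (leT := fun a b : C => `|b| <= `|a|)) => //.
- by move=> y x z xy yz; exact: le_trans yz xy.
- by rewrite inE (leq_ltn_trans ij).
Qed.

Section Deflation.
Variables (C : numClosedFieldType) (n s : nat) (P : 'M[C]_n) (lam : seq C).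
Variables (u v : 'I_s -> 'cV[C]_n).
Hypotheses (lamP : sorted_eigenvalues P lam) (le_sn : (s <= n)%N).

Let U := cols_mx u.
Let V := (cols_mx v)^t*.
Let Lam := diag_mx (\row_(i < s) lam`_i).

Lemma deflation_mxE : deflation_mx lam u v = U *m Lam *m V.
Proof. by rewrite /deflation_mx sum_outer. Qed.

Lemma right_eigenvectors_mx : right_eigenvectors P lam u -> P *m U = U *m Lam.
Proof.
case=> _ Pu; apply/matrixP => a i; rewrite mul_mx_diag !mxE.
have := congr1 (fun w : 'cV[C]_n => w a 0) (Pu i); rewrite !mxE mulrC => <-.
by apply: eq_bigr => b _; rewrite mxE.
Qed.

Lemma deflated_mul_cols :
  right_eigenvectors P lam u -> biorthonormal u v ->
  (P - deflation_mx lam u v) *m U = 0.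
Proof.
move=> /right_eigenvectors_mx PU /biorthonormal_mx VU.
by rewrite deflation_mxE mulmxBl PU -!mulmxA VU mulmx1 subrr.
Qed.

(** In [char_poly_deflation] the factor carrying the first s eigenvalues is monic, so it cancels
    from both sides; the factor X^s supplies the s zero roots. *)
Lemma char_poly_deflated :
  right_eigenvectors P lam u -> biorthonormal u v ->
  char_poly (P - deflation_mx lam u v) =
  \prod_(z <- nseq s 0 ++ drop s lam) ('X - z%:P).
Proof.
move=> /right_eigenvectors_mx PU /biorthonormal_mx VU.
have := char_poly_deflation PU VU; rewrite -deflation_mxE char_poly_diag.
have -> : \prod_(i < s) ('X - ((\row_i0 lam`_i0) 0 i)%:P) =
          \prod_(z <- take s lam) ('X - z%:P) :> {poly C}.
  have sz : size (take s lam) = s.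
    by rewrite size_takel// (sorted_eigenvalues_size lamP).
  rewrite (big_nth 0) sz big_mkord; apply: eq_bigr => i _.
  by rewrite mxE nth_take.
case: lamP => -> _; rewrite -[in RHS](cat_take_drop s lam) => /eqP eq_char.
apply/eqP.
rewrite -(inj_eq (mulIf (_ : \prod_(z <- take s lam) ('X - z%:P) != 0))).
  rewrite (eqP eq_char) !big_cat /= big_nseq subr0 iter_mulr mulr1.
  by apply/eqP; ring.
by rewrite monic_neq0 ?monic_prod_XsubC.
Qed.

Lemma schur_biorthonormal : schur_deflation P lam u v -> biorthonormal u v.
Proof.
case=> Q [T [Qu _ _ _ [uQ vu]]] i j; rewrite vu.
have Q1 : Q^t* *m Q = 1%:M by rewrite -[Q^t*]mul1mx mulmxKtV.
apply/matrixP => a b; rewrite !ord1.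
have := congr1
  (fun B : 'M[C]_n => B (widen_ord le_sn i) (widen_ord le_sn j)) Q1.
rewrite (uQ i (widen_ord le_sn i))// (uQ j (widen_ord le_sn j))//.
rewrite !mxE eqxx => eqQ; rewrite mulr1n; apply: etrans eqQ.
by apply: eq_bigr => k _; rewrite !mxE.
Qed.

(** Padding the coefficients with zeros extends the sum to all columns of [Q], so that both rank-s
    sums become diagonal in the Schur basis. *)
Lemma schur_sum_outer (Q : 'M[C]_n) (c : nat -> C) :
  (forall (i : 'I_s) (j : 'I_n), (i = j :> nat) -> u i = col j Q) ->
  (forall i, v i = u i) ->
  \sum_(i < s) c i *: (u i *m (v i)^t*) =
  Q *m diag_mx (\row_(j < n) (if (j < s)%N then c j else 0)) *m Q^t*.
Proof.
move=> uQ vu; have -> : Q = cols_mx (fun j => col j Q).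
  by apply/matrixP => a j; rewrite !mxE.
rewrite -sum_outer.
rewrite (eq_bigr (fun j : 'I_n => if (j < s)%N then
    c j *: (col j Q *m (col j Q)^t*) else 0)); last first.
  by move=> j _; case: ifP => // _; rewrite scale0r.
rewrite -big_mkcond (big_ord_narrow le_sn); apply: eq_bigr => i _.
by rewrite vu (uQ i (widen_ord le_sn i)).
Qed.

End Deflation.

(** * Decay of the error for each kind of deflation *)

Lemma mulmx_conj (C : comPzRingType) (n : nat) (Q Q' A B : 'M[C]_n) (c : C) :
  Q' *m Q = 1%:M ->
  (Q *m A *m Q') *m (c *: (Q *m B *m Q')) = Q *m (A *m (c *: B)) *m Q'.
Proof.
move=> Q1; rewrite scalemxAl scalemxAr -!mulmxA; congr (_ *m (_ *m _)).
by rewrite mulmxA Q1 mul1mx.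
Qed.

Section ErrorDecay.
Variables (R : realType) (n s : nat) (P : 'M[R[i]]_n) (lam : seq R[i]).
Variables (u v : 'I_s -> 'cV[R[i]]_n) (gamma : R[i]) (e : nat -> 'cV[R[i]]_n).
Hypotheses (lamP : sorted_eigenvalues P lam) (le_sn : (s <= n)%N).

Let D := deflation_mx lam u v.
Let S : 'M[R[i]]_n := 1%:M + \sum_(i < s)
  (gamma * lam`_i / (1 - gamma * lam`_i)) *: (u i *m (v i)^t*).
Hypothesis eE : forall k, e k.+1 = S *m (gamma *: (P - D)) *m e k.

Let norm_tail z : z \in drop s lam -> `|gamma * z| <= `|gamma * lam`_s|.
Proof.
move=> /(nthP 0)[i _ <-]; rewrite nth_drop !normrM ler_wpM2l//.
by rewrite (sorted_eigenvalues_le lamP)// leq_addr.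
Qed.

(* (P - D) annihilates the columns of U, so G S = G for G := gamma (P - D),
   and (S G)^k = S G^k. *)
Lemma eigenvector_deflation_decay :
  right_eigenvectors P lam u -> biorthonormal u v ->
  tildeO_geom e `|gamma * lam`_s| (e 0%N).
Proof.
move=> Pu uv; pose G := gamma *: (P - D).
have GS : G *m S = G.
  rewrite /S sum_outer mulmxDr mulmx1 2!mulmxA -scalemxAl.
  by rewrite deflated_mul_cols// scaler0 !mul0mx addr0.
have iterE k : e k.+1 = S *m G ^+ k.+1 *m (1%:M *m e 0%N).
  elim: k => [|k IHk]; first by rewrite eE expr1 mul1mx.
  rewrite eE -/G IHk [G ^+ k.+2]exprS; move: (G ^+ k.+1) => H.
  by rewrite !mulmxA -[S *m G *m S]mulmxA GS.
apply: annihilated_tildeO iterE => //; last first.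
  apply: prod_scale_sub; apply: prod_char_poly_roots.
  exact: (char_poly_deflated lamP le_sn).
move=> _ /mapP[z z_in ->]; move: z_in; rewrite mem_cat => /orP[|/norm_tail//].
by rewrite mem_nseq => /andP[_ /eqP->]; rewrite mulr0 normr0.
Qed.

(* In the Schur basis Q the iteration matrix is upper triangular, with diagonal
   0 at the s deflated positions and gamma * lambda_j elsewhere. *)
Lemma schur_deflation_decay :
  schur_deflation P lam u v -> tildeO_geom e `|gamma * lam`_s| (e 0%N).
Proof.
case=> Q [T [Qu PQ Tup Tdiag [uQ vu]]].
pose dg (c : nat -> R[i]) : 'M[R[i]]_n :=
  diag_mx (\row_(j < n) (if (j < s)%N then c j else 0)).
pose cS k := gamma * lam`_k / (1 - gamma * lam`_k).
pose T' := (1%:M + dg cS) *m (gamma *: (T - dg (nth 0 lam))).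
have Q1 : Q^t* *m Q = 1%:M by rewrite -[Q^t*]mul1mx mulmxKtV.
have QQ : Q *m Q^t* = 1%:M by exact/unitarymxP.
have SE : S = Q *m (1%:M + dg cS) *m Q^t*.
  by rewrite mulmxDr mulmx1 mulmxDl QQ /S (schur_sum_outer le_sn cS uQ vu).
have PD : P - D = Q *m (T - dg (nth 0 lam)) *m Q^t*.
  by rewrite mulmxBr mulmxBl -PQ /D -(schur_sum_outer le_sn (nth 0 lam) uQ vu).
have eT k : e k.+1 = Q *m T' *m Q^t* *m e k.
  by rewrite eE SE PD (mulmx_conj _ _ _ Q1).
have iterE k : e k.+1 = Q *m T' ^+ k.+1 *m (Q^t* *m e 0%N).
  elim: k => [|k IHk]; first by rewrite eT expr1 !mulmxA.
  rewrite eT IHk [T' ^+ k.+2]exprS; move: (T' ^+ k.+1) => H.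
  by rewrite -!mulmxA [Q^t* *m (Q *m _)]mulmxA Q1 mul1mx.
(* The left factor is diagonal and only scales rows, so triangularity and the diagonal can be read
   off entrywise. *)
have T'E i j : T' i j = (1 + (if (i < s)%N then cS i else 0)) *
    (gamma * (T i j - (if (i < s)%N then lam`_i else 0) *+ (i == j))).
  by rewrite /T' -diag_const_mx -raddfD mul_diag_mx !mxE.
(* [is_trig_mx] means lower triangular, hence the transpose. *)
have T'up : is_trig_mx T'^T.
  apply/is_trig_mxP => i j ij; rewrite mxE T'E Tup//.
  by rewrite -val_eqE /= gtn_eqF// subrr !mulr0.
apply: (annihilated_tildeO (l := [seq T' j j | j <- enum 'I_n])) iterE => //.
  move=> _ /mapP[j _ ->]; rewrite T'E Tdiag eqxx mulr1n.
  have [js|sj] := ltnP j s; first by rewrite subrr !mulr0 normr0.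
  rewrite addr0 mul1r subr0 !normrM ler_wpM2l//.
  exact: (sorted_eigenvalues_le lamP).
apply: prod_char_poly_roots.
rewrite -char_poly_tr char_poly_trig// big_map big_enum.
by apply: eq_bigr => j _; rewrite mxE.
Qed.

Lemma deflation_decay :
  is_deflation P lam u v -> tildeO_geom e `|gamma * lam`_s| (e 0%N).
Proof.
case=> [[Pu _ uv]|[Pu uv]|]; last exact: schur_deflation_decay.
- exact: eigenvector_deflation_decay.
- exact: eigenvector_deflation_decay.
Qed.

End ErrorDecay.

(** * Application to the decision process *)

Lemma is_deflation_biorthonormal (C : numClosedFieldType) (n s : nat)
    (P : 'M[C]_n) (lam : seq C) (u v : 'I_s -> 'cV[C]_n) :
  (s <= n)%N -> is_deflation P lam u v -> biorthonormal u v.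
Proof. by move=> sn [[]|[]|/(schur_biorthonormal sn)]. Qed.

Lemma eigenvalue_transition_le1 (R : realType) (X : finType)
    (d : measure_display) (A : measurableType d) (M : mdp R X A)
    (pi : policy R X A) (lam : seq R[i]) (k : nat) :
  sorted_eigenvalues (to_complex_mx (transition_mx M pi)) lam ->
  `|lam`_k| <= 1.
Proof.
case=> charP _; have [ltk|gek] := ltnP k (size lam); last first.
  by rewrite nth_default// normr0.
have [P0 P1] := transition_mx_stochastic M pi.
apply: (@stochastic_eigenvalue_le1 _ _ (to_complex_mx (transition_mx M pi))).
- by move=> i j; rewrite mxE ler0c.
- move=> i; rewrite -[RHS](rmorph1 (real_complex R)) -(P1 i) rmorph_sum.
  by apply: eq_bigr => j _; rewrite mxE.
- by rewrite charP root_prod_XsubC mem_nth.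
Qed.

Theorem corollary3p2 (R : realType) (X : finType) (d : measure_display)
    (A : measurableType d) (M : mdp R X A) (pi : policy R X A)
    (Vpi : 'cV[R]_#|X|) (lam : seq R[i]) (s : nat)
    (u v : 'I_s -> 'cV[R[i]]_#|X|) :
  integrable_reward M pi ->
  is_value_function M pi Vpi ->
  let P := to_complex_mx (transition_mx M pi) in
  let r := to_complex_mx (reward_vec M pi) in
  let gamma := (discount M)%:C in
  sorted_eigenvalues P lam ->
  (1 <= s <= #|X|)%N ->
  is_deflation P lam u v ->
  (forall W V : nat -> 'cV[R[i]]_#|X|,
     is_ddvi P lam u v 1 gamma r W V <->
     is_ddvi_simplified P lam u v gamma r W V) /\
  (forall (V0 : 'cV[R]_#|X|) (W V : nat -> 'cV[R[i]]_#|X|),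
     V 0%N = to_complex_mx V0 ->
     is_ddvi P lam u v 1 gamma r W V ->
     tildeO_geom (fun k => V k - to_complex_mx Vpi)
       `|gamma * lam`_s| (to_complex_mx (V0 - Vpi))).
Proof.
move=> _ VpiP P r gamma lamP /andP[_ sn] uvP.
split=> [W V|V0 W V V00 /ddvi1_simplified WV]; first exact: ddvi1_simplified.
have VpiE : (1%:M - gamma *: P) *m to_complex_mx Vpi = r.
  rewrite /r -VpiP /to_complex_mx map_mxM map_mxB map_mx1.
  by rewrite map_mxZ.
(* No denominator of the correction vanishes, because |gamma lambda_i| <= gamma < 1. *)
have lt1 (i : 'I_s) : 1 - gamma * lam`_i != 0.
  rewrite subr_eq0; apply: contraTneq isT => eq1.
  have : `|gamma * lam`_i| < 1.
    rewrite normrM (le_lt_trans (y := `|gamma|))//.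
      by rewrite ler_piMr// (eigenvalue_transition_le1 _ lamP).
    by rewrite ger0_norm ?ler0c ?discount_ge0// -[1]/(1%:C) ltcR discount_lt1.
  by rewrite -eq1 normr1 ltxx.
have uv := is_deflation_biorthonormal sn uvP.
have := correction_inverse (biorthonormal_mx uv) lt1.
rewrite -!sum_outer.
have -> : \sum_(i < s) (gamma * lam`_i) *: (u i *m (v i)^t*) =
    gamma *: deflation_mx lam u v.
  by rewrite scaler_sumr; apply: eq_bigr => i _; rewrite scalerA.
(* Eliminating [W] leaves a single recursion for [V]. *)
move=> invS; have VE k := etrans (WV k).2 (congr1 _ (WV k).1).
have errE := ddvi_error VpiE invS VE.
have -> : to_complex_mx (V0 - Vpi) = V 0%N - to_complex_mx Vpi.
  by rewrite V00 /to_complex_mx map_mxB.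
pose e k := V k - to_complex_mx Vpi.
have eE k : e k.+1 = _ *m e k := errE k.
exact: (deflation_decay lamP sn eE uvP).
Qed.
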